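(* Let $a,b\in\mathbb{R}$, $\beta\ge 0$ (case $\alpha=1$), and let $(u_i(t))_{i\in\mathbb{T}_h}$, $t>0$, be a positive solution of the finite-difference scheme described in the context. Let $S_1^h=h\sum_{i\in\mathbb{T}_h}u_i(\log u_i-1)$ and $$K(1,\beta)=-2+(3a-4\beta+9)-2\beta^2+(3a+9)\beta-9(a+b+1).$$ (i) If $K(1,\beta)\ge0$, then $dS_1^h/dt\le 0$ for all $t>0$. (ii) If $K(1,\beta)>0$, then there is a constant $c(1,\beta)>0$ with $P_1(\xi_1,\xi_2)\ge c(1,\beta)(\xi_2^2+\xi_1^4)$ for all $(\xi_1,\xi_2)\in\mathbb{R}^2$, where $$P_1(\xi_1,\xi_2)=(\lambda_1-\lambda_3)\xi_2^2+(-\lambda_1+\lambda_2-\lambda_4)\xi_2\xi_1^2-\lambda_2\xi_1^4,$$ and with this constant, for all $t>0$, $$\frac{dS_1^h}{dt}+c(1,\beta)\,h\sum_{i\in\mathbb{T}_h}\bar u_i^{\beta+1}\big(\xi_{2,i}^2+\xi_{1,i}^4\big)\le 0 .$$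
   Context: Grid: $h=1/N$ with $N$ a positive integer, $\mathbb{T}_h$ is the discrete torus of grid size $h$, whose points are indexed by $i\in\mathbb{Z}/N\mathbb{Z}$ (index $i$ corresponds to the point $ih$), so indices are taken modulo $N$. Scheme (a system of ODEs in $t$), with $v_i=\log u_i$ and $w_i=-u_i^{-1}$: $$\partial_t u_i=-\frac1h(J_{i+1/2}-J_{i-1/2}),\qquad J_{i+1/2}=\frac1h(A_{i+1}-A_i)-\frac1{2h}(w_{i+1}+w_i)(B_{i+1}-B_i),$$ $$A_i=-\bar u_i^{\beta+1}\big(\lambda_1\xi_{2,i}+\lambda_2\xi_{1,i}^2\big),\qquad B_i=\bar u_i^{\beta+1}\big(\lambda_3\xi_{2,i}+\lambda_4\xi_{1,i}^2\big),$$ $$\xi_{2,i}=\frac1{2h^2}\big((v_{i+1}-v_i)(w_{i+1}+w_i)-(v_i-v_{i-1})(w_i+w_{i-1})\big),$$ $$\xi_{1,i}^2=\xi_{2,i}+\frac1{h^2}(v_{i+1}-2v_i+v_{i-1}).$$ Here $\xi_{1,i}^2$ is just the name of the real number defined by the last formula, and $\xi_{1,i}^4=(\xi_{1,i}^2)^2$. $\bar u_i>0$ is an arbitrary average of the (positive) values of $u$ around the grid point $i$. Coefficients: $$\lambda_4=\frac19\big(\beta^2-(3a+14)\beta+9(a+b)+3\big),\qquad \lambda_1=\frac{\beta^2-a\beta+a+2b+3}{\beta+3}-\frac{2}{\beta+3}\lambda_4,$$ $$\lambda_2=-\frac{2a+b+6}{\beta+3}+\frac{\beta+4}{\beta+3}\lambda_4,\qquad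 \lambda_3=\frac{\beta^2-a\beta-\beta+a+2b}{\beta+3}-\frac{2}{\beta+3}\lambda_4.$$ *)

(* Defs.v *)
From HB Require Import structures.
From mathcomp Require Import all_boot all_order all_algebra.
From mathcomp Require Import all_classical all_reals all_analysis.

Set Implicit Arguments.
Unset Strict Implicit.
Unset Printing Implicit Defensive.

Import Order.TTheory GRing.Theory Num.Theory.
Import numFieldNormedType.Exports.

Local Open Scope ring_scope.

Definition lambda4 (R : realType) (a b beta : R) : R :=
  (beta ^+ 2 - (3 * a + 14) * beta + 9 * (a + b) + 3) / 9.

Definition lambda1 (R : realType) (a b beta : R) : R :=
  (beta ^+ 2 - a * beta + a + 2 * b + 3) / (beta + 3)
  - 2 / (beta + 3) * lambda4 a b beta.

Definition lambda2 (R : realType) (a b beta : R) : R :=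
  - ((2 * a + b + 6) / (beta + 3))
  + (beta + 4) / (beta + 3) * lambda4 a b beta.

Definition lambda3 (R : realType) (a b beta : R) : R :=
  (beta ^+ 2 - a * beta - beta + a + 2 * b) / (beta + 3)
  - 2 / (beta + 3) * lambda4 a b beta.

Definition K1 (R : realType) (a b beta : R) : R :=
  - 2 + (3 * a - 4 * beta + 9) - 2 * beta ^+ 2 + (3 * a + 9) * beta
  - 9 * (a + b + 1).

Definition P1 (R : realType) (a b beta xi1 xi2 : R) : R :=
  (lambda1 a b beta - lambda3 a b beta) * xi2 ^+ 2
  + (- lambda1 a b beta + lambda2 a b beta - lambda4 a b beta)
    * xi2 * xi1 ^+ 2
  - lambda2 a b beta * xi1 ^+ 4.

(* A grid function on the discrete torus with N points is a function on 'I_N;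
   the neighbours i + 1 and i - 1 modulo N are [ordS i] and [ord_pred i]. *)

Definition mesh (R : realType) (N : nat) : R := N%:R^-1.

Definition logu (R : realType) (N : nat) (u : 'I_N -> R) (i : 'I_N) : R :=
  ln (u i).

Definition winv (R : realType) (N : nat) (u : 'I_N -> R) (i : 'I_N) : R :=
  - (u i)^-1.

Definition xi2 (R : realType) (N : nat) (u : 'I_N -> R) (i : 'I_N) : R :=
  let h := mesh R N in let v := logu u in let w := winv u in
  1 / (2 * h ^+ 2)
  * ((v (ordS i) - v i) * (w (ordS i) + w i)
     - (v i - v (ord_pred i)) * (w i + w (ord_pred i))).

(* The number written xi_{1,i}^2 in the scheme; it may be negative, and
   xi_{1,i}^4 denotes its square. *)
Definition xi1sq (R : realType) (N : nat) (u : 'I_N -> R) (i : 'I_N) : R :=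
  let h := mesh R N in let v := logu u in
  xi2 u i + 1 / h ^+ 2 * (v (ordS i) - 2 * v i + v (ord_pred i)).

Definition fluxA (R : realType) (a b beta : R) (N : nat)
    (u ubar : 'I_N -> R) (i : 'I_N) : R :=
  - (ubar i `^ (beta + 1)
     * (lambda1 a b beta * xi2 u i + lambda2 a b beta * xi1sq u i)).

Definition fluxB (R : realType) (a b beta : R) (N : nat)
    (u ubar : 'I_N -> R) (i : 'I_N) : R :=
  ubar i `^ (beta + 1)
  * (lambda3 a b beta * xi2 u i + lambda4 a b beta * xi1sq u i).

(* J_{i+1/2}, indexed by the left end point i of the edge. *)
Definition flux (R : realType) (a b beta : R) (N : nat)
    (u ubar : 'I_N -> R) (i : 'I_N) : R :=
  let h := mesh R N in let w := winv u in
  let A := fluxA a b beta u ubar in let B := fluxB a b beta u ubar in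
  1 / h * (A (ordS i) - A i)
  - 1 / (2 * h) * (w (ordS i) + w i) * (B (ordS i) - B i).

(* m is an average of the values of u over the stencil D: it lies between two
   of these values.  This covers arithmetic, geometric, logarithmic, weighted
   and other means. *)
Definition is_average (R : realType) (N : nat) (u : 'I_N -> R)
    (D : {set 'I_N}) (m : R) : Prop :=
  exists j k : 'I_N, [/\ j \in D, k \in D & u j <= m <= u k].

(* The arguments of u and ubar are the time and the grid index. The stencil on
   which the average at a grid point is taken is left arbitrary; positivity of
   u and of its average is required for positive times only. *)
Record positive_solution (R : realType) (a b beta : R) (N : nat)
    (stencil : 'I_N -> {set 'I_N}) (u ubar : R -> 'I_N -> R) : Prop := {
  solution_gt0 : forall t : R, 0 < t -> forall i : 'I_N, 0 < u t i ;
  average_gt0 : forall t : R, 0 < t -> forall i : 'I_N, 0 < ubar t i ;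
  average_near : forall t : R, 0 < t -> forall i : 'I_N,
    is_average (u t) (stencil i) (ubar t i) ;
  solution_ode : forall t : R, 0 < t -> forall i : 'I_N,
    is_derive t (1 : R) (fun s => u s i)
      (- (1 / mesh R N) * (flux a b beta (u t) (ubar t) i
                           - flux a b beta (u t) (ubar t) (ord_pred i)))
}.

Definition entropy (R : realType) (N : nat) (u : 'I_N -> R) : R :=
  mesh R N * \sum_(i < N) u i * (ln (u i) - 1).

(* Main.v *)
(* Put X = xi_1^2, x = xi_2 and s = (beta + 4) / 3. The derivative of the
   entropy is the sum of v_i times the right-hand side of the scheme. Two
   discrete summations by parts turn the increments of A and B into the second
   difference of v, which is h^2 (X - x), and into 2 h^2 x. What remains is
   minus a weighted sum of a quadratic form in (x, X), and the choice of the
   coefficients lambda makes that form equal to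
     (x - s X)^2 + K(1, beta) / 9 X^2,
   which is nonnegative for X of either sign. *)
Require Import Defs.
From HB Require Import structures.
From mathcomp Require Import all_boot all_order all_algebra.
From mathcomp Require Import all_classical all_reals all_analysis.
From mathcomp Require Import ring lra.

Set Implicit Arguments.
Unset Strict Implicit.
Unset Printing Implicit Defensive.

Import Order.TTheory GRing.Theory Num.Theory.
Import numFieldNormedType.Exports.

Local Open Scope ring_scope.

(** [X] is a free real rather than a square, so one identity serves both [P1], with [X = xi1 ^+ 2],
    and the scheme, where [xi1sq] may be negative. The sign of [beta] keeps [beta + 3] away from
    zero. *)
Lemma dissipation_form (R : realType) (a b beta x X : R) : 0 <= beta ->
  (lambda1 a b beta - lambda3 a b beta) * x ^+ 2
  + (- lambda1 a b beta + lambda2 a b beta - lambda4 a b beta) * x * X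
  - lambda2 a b beta * X ^+ 2
  = (x - (beta + 4) / 3 * X) ^+ 2 + K1 a b beta / 9 * X ^+ 2.
Proof.
move=> beta_ge0; rewrite /lambda1 /lambda2 /lambda3 /lambda4 /K1; field.
by apply/eqP; lra.
Qed.

(** The form on the right has determinant [k] and trace [1 + s ^+ 2 + k]. Their quotient is a lower
    bound for its smaller eigenvalue. *)
Lemma sum_sqr_coercive (R : realType) (s k x X : R) : 0 < k ->
  k / (1 + s ^+ 2 + k) * (x ^+ 2 + X ^+ 2) <= (x - s * X) ^+ 2 + k * X ^+ 2.
Proof.
move=> k_gt0; have D_gt0 : 0 < 1 + s ^+ 2 + k by have := sqr_ge0 s; lra.
rewrite mulrAC ler_pdivrMr // -subr_ge0.
rewrite (_ : _ - _ =
  (x - s * X) ^+ 2 + (s * (x - s * X) - k * X) ^+ 2); last by ring.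
by rewrite addr_ge0 // sqr_ge0.
Qed.

Lemma sum_ordS_parts (R : comPzRingType) (N : nat) (f g : 'I_N -> R) :
  \sum_i f i * (g (ordS i) - g i) = - \sum_i (f i - f (ord_pred i)) * g i.
Proof.
(* The torus has no boundary: [ordS] permutes the indices, so no boundary terms appear. *)
have shift : \sum_i f i * g (ordS i) = \sum_i f (ord_pred i) * g i.
  rewrite [RHS](reindex_inj (@ordS_inj N)); apply: eq_bigr => i _.
  by rewrite ordSK.
rewrite -sumrN (eq_bigr (fun i => f i * g (ordS i) - f i * g i)); last first.
  by move=> i _; rewrite mulrBr.
rewrite big_split /= shift -big_split /=; apply: eq_bigr => i _; ring.
Qed.

(** The weight [h] in the entropy cancels the factor [1 / h] of the scheme, which leaves exactly the
    left-hand side as the entropy derivative. *)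
Lemma entropy_production (R : realType) (a b beta : R) (N : nat)
    (u ubar : 'I_N -> R) : 0 <= beta -> (0 < N)%N ->
  - \sum_i logu u i *
      (flux a b beta u ubar i - flux a b beta u ubar (ord_pred i))
  = - (mesh R N * \sum_i ubar i `^ (beta + 1) *
         ((xi2 u i - (beta + 4) / 3 * xi1sq u i) ^+ 2
          + K1 a b beta / 9 * xi1sq u i ^+ 2)).
Proof.
move=> beta_ge0 N_gt0.
set v := logu u; set w := winv u; set h := mesh R N.
have h_neq0 : h != 0 by rewrite invr_neq0 // pnatr_eq0 -lt0n.
set A := fluxA a b beta u ubar; set B := fluxB a b beta u ubar.
pose dv i := v (ordS i) - v i.
pose e i := dv i * (w (ordS i) + w i).
have -> : - \sum_i v i *
    (flux a b beta u ubar i - flux a b beta u ubar (ord_pred i))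
  = \sum_i flux a b beta u ubar i * dv i.
  rewrite sum_ordS_parts; congr (- _); apply: eq_bigr => i _; exact: mulrC.
have -> : \sum_i flux a b beta u ubar i * dv i
  = 1 / h * \sum_i dv i * (A (ordS i) - A i)
    - 1 / (2 * h) * \sum_i e i * (B (ordS i) - B i).
  rewrite !mulr_sumr -sumrB; apply: eq_bigr => i _.
  by rewrite /flux -/h -/A -/B -/w /e; ring.
(* The second summation by parts moves the differences from [A] onto [dv] and from [B] onto [e]. *)
rewrite !sum_ordS_parts !mulrN opprK !mulr_sumr -!sumrN -big_split /=.
apply: eq_bigr => i _.
have dvE : dv i - dv (ord_pred i) = h ^+ 2 * (xi1sq u i - xi2 u i).
  by rewrite /dv ord_predK /xi1sq -/v -/h; field.
have eE : e i - e (ord_pred i) = 2 * h ^+ 2 * xi2 u i.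
  by rewrite /e /dv ord_predK /xi2 -/v -/w -/h; field.
rewrite dvE eE -dissipation_form // /A /B /fluxA /fluxB.
by field.
Qed.

Lemma is_derive_xlnx (R : realType) (f : R -> R) (t df : R) :
  0 < f t -> is_derive t (1 : R) f df ->
  is_derive t (1 : R) (fun s => f s * (ln (f s) - 1)) (df * ln (f t)).
Proof.
move=> ft_gt0 f_df.
have dln : is_derive t (1 : R) (fun s => ln (f s)) (df * (f t)^-1).
  have dl := is_derive1_ln ft_gt0.
  by have := is_derive1_comp dl f_df; rewrite mulrC.
(* The product rule gives [df * (ln (f t) - 1) + f t * (df / f t)], whose last term cancels the
   [- df]. *)
apply: is_derive_eq.
rewrite /GRing.scale /=; field; exact: lt0r_neq0.
Qed.

Lemma is_derive_entropy (R : realType) (a b beta : R) (N : nat)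
    (stencil : 'I_N -> {set 'I_N}) (u ubar : R -> 'I_N -> R) (t : R) :
  0 <= beta -> (0 < N)%N -> positive_solution a b beta stencil u ubar ->
  0 < t ->
  is_derive t (1 : R) (fun s => entropy (u s))
    (- (mesh R N * \sum_i ubar t i `^ (beta + 1) *
         ((xi2 (u t) i - (beta + 4) / 3 * xi1sq (u t) i) ^+ 2
          + K1 a b beta / 9 * xi1sq (u t) i ^+ 2))).
Proof.
move=> beta_ge0 N_gt0 sol t_gt0.
have h_neq0 : mesh R N != 0 by rewrite invr_neq0 // pnatr_eq0 -lt0n.
have dterm i := is_derive_xlnx (solution_gt0 sol t_gt0 i)
  (solution_ode sol t_gt0 i).
have dsum := is_derive_sum dterm.
rewrite -entropy_production //.
have -> : (fun s => entropy (u s)) =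
    mesh R N \*: (\sum_i (fun s => u s i * (ln (u s i) - 1))).
  by apply/funext => s; rewrite /entropy /= fct_sumE.
apply: is_derive_eq.
rewrite /GRing.scale /= mulr_sumr -sumrN; apply: eq_bigr => i _.
rewrite /logu; by field.
Qed.

Theorem proposition8 (R : realType) (a b beta : R) (hbeta : 0 <= beta) :
  (0 <= K1 a b beta ->
   forall (N : nat) (stencil : 'I_N -> {set 'I_N}) (u ubar : R -> 'I_N -> R),
     (0 < N)%N -> positive_solution a b beta stencil u ubar ->
     forall t : R, 0 < t ->
       derivable (fun s : R => entropy (u s)) t 1 /\
       derive1 (fun s : R => entropy (u s)) t <= 0)
  /\
  (0 < K1 a b beta ->
   exists c : R,
     [/\ 0 < c,
         forall x1 x2 : R,
           c * (x2 ^+ 2 + x1 ^+ 4) <= P1 a b beta x1 x2 &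
         forall (N : nat) (stencil : 'I_N -> {set 'I_N})
           (u ubar : R -> 'I_N -> R),
           (0 < N)%N -> positive_solution a b beta stencil u ubar ->
           forall t : R, 0 < t ->
             derivable (fun s : R => entropy (u s)) t 1 /\
             derive1 (fun s : R => entropy (u s)) t
             + c * mesh R N * (\sum_(i < N) ubar t i `^ (beta + 1)
                 * (xi2 (u t) i ^+ 2 + xi1sq (u t) i ^+ 2)) <= 0]).
Proof.
split=> [K_ge0 N stencil u ubar N_gt0 sol t t_gt0|K_gt0].
  have dS := is_derive_entropy hbeta N_gt0 sol t_gt0.
  split; first exact: ex_derive.
  rewrite derive1E derive_val oppr_le0 mulr_ge0 ?invr_ge0 ?ler0n //.
  apply: sumr_ge0 => i _; rewrite mulr_ge0 ?powR_ge0 // addr_ge0 ?sqr_ge0 //.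
  by rewrite mulr_ge0 ?sqr_ge0 // divr_ge0.
have k_gt0 : 0 < K1 a b beta / 9 by rewrite divr_gt0.
have coercive x X := sum_sqr_coercive ((beta + 4) / 3) x X k_gt0.
(* With [k = K1 a b beta / 9] and [s = (beta + 4) / 3], this names [k / (1 + s ^+ 2 + k)], which is
   independent of the grid and of the solution. *)
set c := (X in forall x X0, X * _ <= _) in coercive.
exists c; split=> [|x1 x2|N stencil u ubar N_gt0 sol t t_gt0].
- by rewrite divr_gt0 // ltr_wpDl // addr_ge0 ?sqr_ge0.
- rewrite /P1 (exprM x1 2 2) dissipation_form //; exact: coercive.
have dS := is_derive_entropy hbeta N_gt0 sol t_gt0.
split; first exact: ex_derive.
rewrite derive1E derive_val addrC subr_le0 (mulrC c) -mulrA.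
rewrite ler_wpM2l ?invr_ge0 ?ler0n // mulr_sumr ler_sum // => i _.
by rewrite mulrCA ler_wpM2l ?powR_ge0 ?coercive.
Qed.
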